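(* Let $L_1,K_1,\ldots,K_n\in\mathcal S^n$ and $\phi\in\mathcal C$. Then $$\frac{d}{d\varepsilon}\bigg|_{\varepsilon=0^+}\widetilde V(L_1\widehat+_\phi\varepsilon\cdot K_1,K_2,\ldots,K_n)=\frac{1}{n\,\phi'_r(1)}\int_{S^{n-1}}\phi\left(\frac{\rho(K_1,u)}{\rho(L_1,u)}\right)\rho(L_1,u)\rho(K_2,u)\cdots\rho(K_n,u)\,dS(u).$$
   Context: $\mathcal S^n$ is the set of star bodies (about the origin) in $\mathbb R^n$: compact sets $K$, star-shaped with respect to the origin, whose radial function $\rho(K,u)=\max\{c\ge 0: cu\in K\}$, $u\in S^{n-1}$, is positive and continuous. $S$ denotes spherical Lebesgue measure on $S^{n-1}$. $\mathcal C$ is the class of convex, decreasing functions $\phi:(0,\infty)\to(0,\infty)$ with $\lim_{t\to 0^+}\phi(t)=\infty$ (convention $\phi(0)=\infty$) and $\lim_{t\to\infty}\phi(t)=0$. $\phi'_r$ denotes the right derivative of $\phi$. The dual mixed volume of $K_1,\ldots,K_n\in\mathcal S^n$ is $\widetilde V(K_1,\ldots,K_n)=\frac1n\int_{S^{n-1}}\rho(K_1,u)\cdots\rho(K_n,u)\,dS(u)$. For $K,L\in\mathcal S^n$ and $\varepsilon\ge 0$, the Orlicz harmonic linear combination $K\widehat+_\phi\varepsilon\cdot L$ is the star body $M$ whose radial function is determined by $$\phi\left(\frac{\rho(K,u)}{\rho(M,u)}\right)+\varepsilon\,\phi\left(\frac{\rho(L,u)}{\rho(M,u)}\right)=\phi(1),\qquad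 u\in S^{n-1}.$$ The derivative $\frac{d}{d\varepsilon}\big|_{\varepsilon=0^+}$ is the one-sided (right) derivative at $\varepsilon=0$; note $L_1\widehat+_\phi 0\cdot K_1=L_1$. *)

(* Defs.v *)
From HB Require Import structures.
From mathcomp Require Import all_boot all_order all_algebra.
From mathcomp Require Import all_classical all_reals all_analysis.
From mathcomp Require Import measurable_realfun.

Set Implicit Arguments.
Unset Strict Implicit.
Unset Printing Implicit Defensive.

Import Order.TTheory GRing.Theory Num.Theory.
Import numFieldNormedType.Exports.

Local Open Scope classical_set_scope.
Local Open Scope ring_scope.

(* R^n is ['rV[R]_n], with the topology of the library.  Its sigma-algebra is
   generated by the coordinate projections; for T = R this is the Borel
   sigma-algebra. *)
Section measurable_rV.
Context {d : measure_display} {T : sigmaRingType d}.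
Variable n : nat.

Let coors : 'I_n -> 'rV[T]_n -> T := fun i x => x ord0 i.

Let rV_set0 : g_sigma_preimage coors set0.
Proof. exact: sigma_algebra0. Qed.

Let rV_setC A : g_sigma_preimage coors A -> g_sigma_preimage coors (~` A).
Proof. exact: sigma_algebraC. Qed.

Let rV_bigcup (F : (set 'rV[T]_n)^nat) : (forall i, g_sigma_preimage coors (F i)) ->
  g_sigma_preimage coors (\bigcup_i (F i)).
Proof. exact: sigma_algebra_bigcup. Qed.

HB.instance Definition _ := @isMeasurable.Build (measure_tuple_display d)
  ('rV[T]_n) (g_sigma_preimage coors) rV_set0 rV_setC rV_bigcup.

End measurable_rV.

Section rV_cons.
Context {R : realType}.
Variable n : nat.

Lemma measurable_coord (i : 'I_n) :
  measurable_fun [set: 'rV[R]_n] (fun x : 'rV[R]_n => x ord0 i).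
Proof.
move=> _ Y mY; rewrite setTI; apply: sub_sigma_algebra => /=.
rewrite -bigcup_seq/=; exists i => /=; first by rewrite mem_index_enum.
by exists Y => //; rewrite setTI.
Qed.

Lemma measurable_fun_rV d (T : measurableType d) (f : T -> 'rV[R]_n) :
  (forall i, measurable_fun [set: T] (fun t => f t ord0 i)) ->
  measurable_fun [set: T] f.
Proof.
move=> mf _ Y mY.
have : preimage_set_system [set: T] f (measurable : set (set 'rV[R]_n))
       `<=` measurable.
  rewrite -(g_sigma_preimage_comp (fun i (x : 'rV[R]_n) => x ord0 i) f).
  apply: smallest_sub; first exact: sigma_algebra_measurable.
  elim/big_ind : _ => //; first by move=> A B sA sB C [/sA|/sB].
  by move=> i _ A [B mB <-]; exact: mf.
by apply; exists Y.
Qed.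

End rV_cons.

Section lebesgue_rV.
Context {R : realType}.

Definition rV_cons n (p : measurableTypeR R * 'rV[R]_n) : 'rV[R]_n.+1 :=
  row_mx (const_mx p.1 : 'rV[R]_1) p.2.

Lemma measurable_rV_cons n : measurable_fun [set: _] (@rV_cons n).
Proof.
apply: measurable_fun_rV => i; rewrite -[n.+1]/(1 + n)%N in i *.
have [j ->|j ->] := split_ordP i.
  under eq_fun do rewrite row_mxEl mxE/=.
  exact: measurable_fst.
under eq_fun do rewrite row_mxEr.
exact: (measurableT_comp (measurable_coord j) measurable_snd).
Qed.

Lemma measurable_rV_uncons n : measurable_fun [set: 'rV[R]_n.+1]
  (fun x : 'rV[R]_(1 + n) => (lsubmx x ord0 ord0, rsubmx x)
     : measurableTypeR R * 'rV[R]_n).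
Proof.
apply/measurable_fun_pairP; split.
  rewrite (_ : _ \o _ = fun x : 'rV[R]_(1 + n) => x ord0 (lshift n ord0)).
    exact: measurable_coord.
  by apply/funext => x /=; rewrite mxE.
apply: measurable_fun_rV => i.
rewrite [X in measurable_fun _ X](_ : _ = fun x : 'rV[R]_(1 + n) => x ord0 (rshift 1 i)).
  exact: measurable_coord.
by apply/funext => x /=; rewrite mxE.
Qed.

Section product_step.
Variables (n : nat) (mu : {sigma_finite_measure set 'rV[R]_n -> \bar R}).

Definition lebesgue_prod : set 'rV[R]_n.+1 -> \bar R :=
  pushforward (lebesgue_measure \x mu)%E (@rV_cons n).

HB.instance Definition _ := Measure.copy lebesgue_prod
  (measure_function_pushforward__canonical__measure_function_Measure
     (lebesgue_measure \x mu)%E (@measurable_rV_cons n)).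

Let lebesgue_prod_sigma_finite : sigma_finite setT lebesgue_prod.
Proof.
have /sigma_finiteP[F [TF ndF Foo]] :=
  sigma_finiteT (@lebesgue_measure R : {sigma_finite_measure set _ -> \bar R}).
have /sigma_finiteP[G [TG ndG Goo]] := sigma_finiteT mu.
pose g := (fun x : 'rV[R]_(1 + n) => (lsubmx x ord0 ord0, rsubmx x)
  : measurableTypeR R * 'rV[R]_n).
have mg : measurable_fun setT g by exact: measurable_rV_uncons.
exists (fun k => g @^-1` (F k `*` G k)).
  apply/esym/seteqP; split => // x _.
  have [i _ Fi] : (\bigcup_k F k) (g x).1 by rewrite -TF.
  have [j _ Gj] : (\bigcup_k G k) (g x).2 by rewrite -TG.
  exists (maxn i j) => //; split.
  - by move: Fi; exact/subsetPset/ndF/leq_maxl.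
  - by move: Gj; exact/subsetPset/ndG/leq_maxr.
move=> k; have [mF Fk] := Foo k; have [mG Gk] := Goo k; split.
  by rewrite -[X in measurable X]setTI; apply: mg => //; exact: measurableX.
rewrite /lebesgue_prod /pushforward -comp_preimage.
rewrite (_ : g \o _ = idfun) ?preimage_id.
  by rewrite product_measure1E// lte_mul_pinfty// ge0_fin_numE.
apply/funext => -[x v]; rewrite /g /rV_cons/= row_mxKl row_mxKr.
by rewrite mxE.
Qed.

HB.instance Definition _ := Measure_isSigmaFinite.Build _ _ _ lebesgue_prod
  lebesgue_prod_sigma_finite.

End product_step.

(* n-dimensional Lebesgue measure, as the n-fold product of [lebesgue_measure];
   R^0 is a point of mass 1. *)
Fixpoint lebesgue_rV n : {sigma_finite_measure set 'rV[R]_n -> \bar R} :=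
  match n with
  | 0 => \d_(0 : 'rV[R]_0)
  | n'.+1 => lebesgue_prod (lebesgue_rV n')
  end.

End lebesgue_rV.

Section sphere.
Context {R : realType}.
Variable n : nat.
Implicit Types x : 'rV[R]_n.

(* The library norm [`|x|] on matrices is the sup norm. *)
Definition enorm x : R := Num.sqrt (\sum_(i < n) x ord0 i ^+ 2).

Definition sphere : set 'rV[R]_n := [set x | enorm x = 1].

Definition punctured_ball : set 'rV[R]_n := [set x | 0 < enorm x <= 1].

Definition normalize x : 'rV[R]_n := (enorm x)^-1 *: x.

Lemma measurable_enorm : measurable_fun [set: 'rV[R]_n] enorm.
Proof.
apply: measurableT_comp; first exact: continuous_measurable_fun (@sqrt_continuous R).
apply: measurable_sum => i; apply: measurable_funX; exact: measurable_coord.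
Qed.

Lemma measurable_punctured_ball : measurable punctured_ball.
Proof.
rewrite (_ : punctured_ball = setT `&` enorm @^-1` `]0, 1]); last first.
  by rewrite setTI; apply/seteqP; split => x /=; rewrite in_itv.
by apply: measurable_enorm => //; exact: measurable_itv.
Qed.

Lemma measurable_normalize : measurable_fun [set: 'rV[R]_n] normalize.
Proof.
apply: measurable_fun_rV => i; under eq_fun do rewrite mxE.
apply: measurable_funM; last exact: measurable_coord.
rewrite (_ : (fun _ => _) = (@powR R ^~ (-1)) \o enorm).
  by apply: measurableT_comp measurable_enorm; exact: measurable_powR.
by apply/funext => x /=; rewrite powR_inv1// sqrtr_ge0.
Qed.

(* Spherical Lebesgue measure on S^(n-1), as a measure on R^n concentrated on the
   sphere: the mass of A is n times the volume of the cone
   {x | 0 < |x| <= 1, x / |x| \in A} over A. *)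
Definition sphere_measure : set 'rV[R]_n -> \bar R := fun A =>
  (n%:R%:E * lebesgue_rV n (normalize @^-1` A `&` punctured_ball))%E.

HB.instance Definition _ := Measure.copy sphere_measure
  (mscale (NngNum (ler0n R n))
    (measure_function_pushforward__canonical__measure_function_Measure
      (mrestr (lebesgue_rV n) measurable_punctured_ball) measurable_normalize)).

End sphere.

Arguments sphere {R} n.
Arguments punctured_ball {R} n.
Arguments sphere_measure {R} n.

Section star_bodies.
Context {R : realType}.
Variable n : nat.
Implicit Types (K L M : set 'rV[R]_n) (u : 'rV[R]_n).

(* For a compact [K] meeting the ray spanned by the unit vector [u], the supremum
   is attained; [sup] of the empty set is 0. *)
Definition radial K u : R := sup [set c : R | 0 <= c /\ K (c *: u)].

Definition star_body K := [/\ compact K,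
  forall x (t : R), K x -> 0 <= t <= 1 -> K (t *: x),
  forall u, sphere n u -> 0 < radial K u &
  {within sphere n, continuous (radial K)}].

Definition dual_mixed_volume (K : 'I_n -> set 'rV[R]_n) : R :=
  n%:R^-1 * \int[sphere_measure n]_(u in sphere n) \prod_(i < n) radial (K i) u.

(* [K +_phi eps . L], by definite description: a star body is determined by its
   radial function. *)
Definition orlicz_harmonic_comb (phi : R -> R) K (eps : R) L : set 'rV[R]_n :=
  xget set0 [set M | star_body M /\ forall u, sphere n u ->
    phi (radial K u / radial M u) + eps * phi (radial L u / radial M u) = phi 1].

End star_bodies.

Section functions.
Context {R : realType}.
Implicit Types (phi f : R -> R) (a : R).

(* Only the values of [phi] on the open half-line matter.  A function in this
   class is automatically strictly decreasing. *)
Definition orlicz_class phi := [/\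
  convex_function (`]0, +oo[ : set R) phi,
  {in `]0, +oo[ &, {homo phi : s t / s <= t >-> t <= s}},
  forall t : R, 0 < t -> 0 < phi t,
  phi t @[t --> 0^'+] --> +oo &
  phi t @[t --> +oo] --> 0].

Definition right_derivative f a : R :=
  lim (h^-1 * (f (a + h) - f a) @[h --> 0^'+]).

Definition is_right_derivative f a (l : R) :=
  h^-1 * (f (a + h) - f a) @[h --> 0^'+] --> l.

End functions.

(* Main.v *)
Require Import Defs.
From mathcomp Require Import all_boot all_order all_algebra.
From mathcomp Require Import all_classical all_reals all_analysis.
From mathcomp Require Import measurable_realfun ring lra.

Set Implicit Arguments.
Unset Strict Implicit.
Unset Printing Implicit Defensive.

Import Order.TTheory GRing.Theory Num.Theory.
Import numFieldNormedType.Exports.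

Local Open Scope classical_set_scope.
Local Open Scope ring_scope.

(* Fix u and write a = rho(L1,u), b = rho(K1,u), r = rho(M,u), where M is the
   combination with parameter e, so that phi(a/r) + e phi(b/r) = phi(1).  Then
   a/r > 1 decreases to 1 as e -> 0+, and
     (r - a)/e = r phi(b/r) (a/r - 1)/(phi(a/r) - phi(1)),
   which tends to a phi(b/a)/phi'_r(1).  Convexity and monotonicity of phi give the
   bound 0 <= (a - r)/e <= a phi(b/a)/(phi(1) - phi(2)), uniform in e and
   continuous in u, so dominated convergence applies on the sphere. *)

(** * Compactness and Borel structure of the Euclidean unit sphere *)

Section sphere_topology.
Context {R : realType}.
Variable n : nat.

Lemma enorm_continuous : continuous (@enorm R n).
Proof.
have ci i : continuous (fun x : 'rV[R]_n => x ord0 i ^+ 2).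
  move=> x; apply: (@continuous_comp _ _ _ (fun y : 'rV[R]_n => y ord0 i) (fun t => t ^+ 2)).
    exact: coord_continuous.
  exact: exprn_continuous.
have cs (s : seq 'I_n) : continuous (fun x : 'rV[R]_n => \sum_(i <- s) x ord0 i ^+ 2).
  elim: s => [|i s IH] x.
    by under eq_fun do rewrite big_nil; exact: cst_continuous.
  under eq_fun do rewrite big_cons.
  exact: (cvgD (ci i x) (IH x)).
move=> x; apply: (@continuous_comp _ _ _ (fun x : 'rV[R]_n =>
  \sum_(i < n) x ord0 i ^+ 2) Num.sqrt); [exact: cs|exact: sqrt_continuous].
Qed.

Lemma enormZ (c : R) (x : 'rV[R]_n) : 0 <= c -> enorm (c *: x) = c * enorm x.
Proof.
move=> c0; rewrite /enorm; under eq_bigr do rewrite mxE exprMn.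
by rewrite -mulr_sumr sqrtrM ?sqr_ge0// sqrtr_sqr ger0_norm.
Qed.

Lemma coord_le_enorm (x : 'rV[R]_n) i : `|x ord0 i| <= enorm x.
Proof.
rewrite -sqrtr_sqr /enorm ler_wsqrtr// (bigD1 i)//= lerDl sumr_ge0// => j _.
exact: sqr_ge0.
Qed.

(** Closed as a level set of the continuous [enorm], and contained in the cube [[-1, 1]^n], a
    product of compact segments. *)
Lemma sphere_compact : compact (@sphere R n).
Proof.
apply: (@subclosed_compact _ _ [set v : 'rV[R]_n | forall i, `[-1, 1]%classic (v ord0 i)]).
- apply: (@closed_comp _ _ (@enorm R n) [set 1]) => [x _|]; first exact: enorm_continuous.
  exact: closed_eq.
- apply: (@rV_compact R n (fun=> `[-1, 1]%classic)) => _; exact: segment_compact.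
- move=> x x1 i /=; rewrite in_itv/= -ler_norml.
  by rewrite (le_trans (coord_le_enorm x i))// x1.
Qed.

Lemma measurable_rV_box (A : 'I_n -> set R) : (forall i, measurable (A i)) ->
  measurable [set x : 'rV[R]_n | forall i, A i (x ord0 i)].
Proof.
move=> mA; rewrite (_ : [set x | _] =
  \bigcap_(i in [set: 'I_n]) ((fun x : 'rV[R]_n => x ord0 i) @^-1` A i)).
  apply: fin_bigcap_measurable; first exact: finite_finset.
  by move=> i _; rewrite -[X in measurable X]setTI; exact: measurable_coord.
by apply/seteqP; split => [x Ax i _|x Ax i]; exact: Ax.
Qed.

(** The sigma-algebra is generated by the coordinates, so its link with the topology needs a proof:
    an open set is the union of the boxes with rational endpoints that it contains, and there are
    countably many of these. *)
Lemma open_rV_measurable (U : set 'rV[R]_n) : open U -> measurable U.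
Proof.
move=> oU.
pose box (q : {ffun 'I_n -> rat * rat}) : set 'rV[R]_n :=
  [set x | forall i, `]ratr (q i).1, ratr (q i).2[%classic (x ord0 i)].
rewrite (_ : U = \bigcup_q (if `[< box q `<=` U >] then box q else set0)).
  apply: countable_bigcupT_measurable => // q.
  case: ifP => // _.
  apply: (@measurable_rV_box (fun i => `]ratr (q i).1, ratr (q i).2[%classic)) => i.
  exact: measurable_itv.
apply/seteqP; split => [x Ux|x [q _]]; last by case: asboolP => // qU /qU.
have /nbhs_ballP[e /= e0 eU] : nbhs x U by exact: open_nbhs_nbhs.
have /choice[q hq] (i : 'I_n) : exists q : rat * rat,
    x ord0 i - e < ratr q.1 < x ord0 i /\ x ord0 i < ratr q.2 < x ord0 i + e.
  have [|a +] := @rat_in_itvoo _ (x ord0 i - e) (x ord0 i); first by rewrite ltrBlDr ltrDl.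
  have [|b +] := @rat_in_itvoo _ (x ord0 i) (x ord0 i + e); first by rewrite ltrDl.
  by rewrite !in_itv/= => ? ?; exists (a, b).
have qx : box (finfun q) x.
  by move=> i /=; rewrite in_itv/= ffunE; have [/andP[_ ->] /andP[-> _]] := hq i.
exists (finfun q) => //; case: asboolP => // -[] y qy; apply: eU.
split=> // i j; rewrite ord1 /ball/=.
have [/andP[a b] /andP[c d]] := hq j.
have := qy j; rewrite /= in_itv/= ffunE => /andP[u v].
by rewrite distrC ltr_distl; lra.
Qed.

Lemma measurable_sphere : measurable (@sphere R n).
Proof.
by have := @measurable_enorm R n measurableT [set 1] (measurable_set1 1); rewrite setTI.
Qed.

Lemma sphere_continuous_measurable (f : 'rV[R]_n -> R) :
  {within @sphere R n, continuous f} -> measurable_fun (@sphere R n) f.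
Proof.
move=> /continuousP cf; apply: (measurability _ (RGenOpens.measurableE R)).
move=> _ [_ [a [b ->] <-]].
have /open_subspaceP[V oV] := cf _ (@interval_open _ (BRight a) (BLeft b) isT isT).
move=> VE; rewrite setIC -VE; apply: measurableI; last exact: measurable_sphere.
exact: open_rV_measurable.
Qed.

End sphere_topology.

(** * Finiteness of the spherical measure and integrability of continuous functions *)

Section sphere_integration.
Context {R : realType}.

Let cube n := [set x : 'rV[R]_n | forall i, `[-1, 1]%classic (x ord0 i)].

(** Induction on the dimension: the cube pulls back along [rV_cons] to [[-1, 1]] times the cube of
    one dimension less, so each step multiplies the volume by 2. *)
Lemma lebesgue_rV_cube_lty n : (lebesgue_rV n (@cube n) < +oo)%E.
Proof.
elim: n => [|n IH] /=; first by rewrite diracE ltry.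
rewrite /lebesgue_prod /pushforward.
rewrite (_ : _ @^-1` _ = `[-1, 1]%classic `*` @cube n).
  rewrite product_measure1E//; last first.
    by apply: (@measurable_rV_box _ _ (fun=> `[-1, 1]%classic)) => i; exact: measurable_itv.
  have I1 : lebesgue_measure (`[-1, 1]%classic : set R) = 2%:E.
    by rewrite lebesgue_measure_itv/= lte_fin ifT -?EFinB; [congr EFin; lra|lra].
  rewrite lte_mul_pinfty//.
  by rewrite [X in X \is a fin_num](_ : _ = 2%:E).
apply/seteqP; split => -[a v] /=; rewrite /rV_cons/=.
  move=> H; split.
    have := row_mxEl (const_mx a : 'rV_1) v ord0 ord0; rewrite [RHS]mxE => <-.
    exact: (H (lshift n ord0 : 'I_(1 + n))).
  move=> i; rewrite -(row_mxEr (const_mx a : 'rV_1) v ord0 i).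
  exact: (H (rshift 1 i : 'I_(1 + n))).
move=> [Ha Hv] i; rewrite -[n.+1]/(1 + n)%N in i *.
have [j ->|j ->] := split_ordP i.
  by have /= -> := row_mxEl (const_mx a : 'rV_1) v ord0 j; rewrite mxE.
by have /= -> := row_mxEr (const_mx a : 'rV_1) v ord0 j; exact: Hv.
Qed.

(** The cone that defines this mass lies in the punctured unit ball, hence in the cube of finite
    volume. *)
Lemma sphere_measure_lty n : (sphere_measure n (@sphere R n) < +oo)%E.
Proof.
rewrite /sphere_measure lte_mul_pinfty// ?lee_fin//.
apply: le_lt_trans (lebesgue_rV_cube_lty n); apply: le_measure; rewrite ?inE.
- apply: measurableI; last exact: measurable_punctured_ball.
  rewrite -[X in measurable X]setTI; apply: measurable_normalize => //.
  exact: measurable_sphere.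
- by apply: (@measurable_rV_box _ _ (fun=> `[-1, 1]%classic)) => i; exact: measurable_itv.
- move=> x [_ /andP[_ x1]] i /=; rewrite in_itv/= -ler_norml.
  exact: le_trans (coord_le_enorm x i) x1.
Qed.

(** Compactness of the sphere bounds [f], and the measure is finite. *)
Lemma sphere_continuous_integrable n (f : 'rV[R]_n -> R) :
  {within @sphere R n, continuous f} ->
  (sphere_measure n).-integrable (@sphere R n) (EFin \o f).
Proof.
move=> cf; apply: measurable_bounded_integrable.
- exact: measurable_sphere.
- exact: sphere_measure_lty.
- exact: sphere_continuous_measurable.
- have [M [Mr MH]] := compact_bounded (continuous_compact cf (@sphere_compact R n)).
  by exists M; split => // y /MH My x Sx; apply: My; exists x.
Qed.

End sphere_integration.

(** * Strict monotonicity, continuity and right derivative at 1 of functions in the class *)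

Section orlicz_functions.
Context {R : realType}.
Variable phi : R -> R.
Hypothesis hphi : orlicz_class phi.
Implicit Types (x y z a b r e : R).

(** Convexity cleared of denominators, so that linear arithmetic can use it; [y] has weight
    [(z - y) / (z - x)] at [x]. The degenerate case [x = z] is allowed. *)
Lemma orlicz_convex x y z : 0 < x -> x <= y -> y <= z ->
  phi y * (z - x) <= phi x * (z - y) + phi z * (y - x).
Proof.
move=> x0 xy yz; have [cphi _ _ _ _] := hphi.
have [xz|zx] := ltP x z; last first.
  have -> : z = x by lra.
  have -> : y = x by lra.
  lra.
have zx0 : 0 < z - x by lra.
have t0 : 0 <= (z - y) / (z - x) by rewrite divr_ge0 //; lra.
have t1 : (z - y) / (z - x) <= 1 by rewrite ler_pdivrMr//; lra.
have /= := cphi (Itv01 t0 t1) x z.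
rewrite !inE/= !in_itv/= !andbT => /(_ x0 (lt_trans x0 xz)).
rewrite !convRE/= /unstable.onem.
have -> : conv (Itv01 t0 t1) (x : convex_lmodType R^o) z =
  (z - y) / (z - x) * x + (1 - (z - y) / (z - x)) * z by [].
rewrite (_ : (z - y) / (z - x) * x + _ = y); last by field; rewrite gt_eqF.
rewrite -(ler_pM2r zx0) => /le_trans; apply.
rewrite le_eqVlt; apply/orP; left; apply/eqP; field.
by rewrite gt_eqF.
Qed.

Lemma orlicz_gt0 x : 0 < x -> 0 < phi x.
Proof. by case: hphi => _ _ + _ _; exact. Qed.

Lemma orlicz_small e : 0 < e -> exists2 y, 0 < y & forall z, y < z -> phi z < e.
Proof.
move=> e0; have [_ _ _ _ p0] := hphi.
have /cvgrPdist_lt/(_ _ e0)[M [Mr HM]] := p0.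
exists (Num.max M 1); first by rewrite lt_max ltr01 orbT.
move=> z; rewrite gt_max => /andP[/HM /= + z1].
by rewrite sub0r normrN gtr0_norm// orlicz_gt0// (lt_trans _ z1).
Qed.

(** If [phi x <= phi y] held, convexity would keep [phi] at or above [phi y] everywhere to the right
    of [y], against the limit 0 at infinity and [phi y > 0]. *)
Lemma orlicz_decreasing x y : 0 < x -> x < y -> phi y < phi x.
Proof.
move=> x0 xy; rewrite ltNge; apply/negP => pxy.
have y0 := lt_trans x0 xy.
have [M M0 HM] := orlicz_small (orlicz_gt0 y0).
pose z := M + y; have /HM pz : M < z by rewrite /z; lra.
have yz : y < z by rewrite /z; lra.
have := orlicz_convex x0 (ltW xy) (ltW yz).
have : 0 < (phi y - phi z) * (y - x) by rewrite mulr_gt0//; lra.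
have : 0 <= (phi y - phi x) * (z - y) by rewrite mulr_ge0//; lra.
lra.
Qed.

Lemma orlicz_nonincreasing x y : 0 < x -> x <= y -> phi y <= phi x.
Proof. by move=> x0; rewrite le_eqVlt => /predU1P[->//|/(orlicz_decreasing x0)/ltW]. Qed.

Lemma orlicz_inj x y : 0 < x -> 0 < y -> phi x = phi y -> x = y.
Proof.
move=> x0 y0 e; have [xy|yx|//] := ltgtP x y.
  by have := orlicz_decreasing x0 xy; rewrite e ltxx.
by have := orlicz_decreasing y0 yx; rewrite e ltxx.
Qed.

(** By convexity, the chord over [[x / 2, x]] is at least as steep as every chord joining [x] to a
    point beyond [x / 2]; its slope gives the local Lipschitz constant [k]. *)
Lemma orlicz_continuous x : 0 < x -> {for x, continuous phi}.
Proof.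
move=> x0; pose k := (phi (x / 2) - phi x) / (x / 2).
have k0 : 0 < k by rewrite divr_gt0 ?subr_gt0 ?orlicz_decreasing//; lra.
have lip y : x / 2 < y -> `|phi x - phi y| <= k * `|x - y|.
  move=> xy; have h0 : 0 < x / 2 by lra.
  have [le_xy|lt_yx] := leP x y.
    rewrite ger0_norm ?subr_ge0 ?orlicz_nonincreasing// ler0_norm; last by lra.
    rewrite /k mulrAC ler_pdivlMr//.
    have := orlicz_convex h0 (y := x) (z := y).
    by move=> /(_ ltac:(lra) le_xy); lra.
  rewrite ler0_norm; last by rewrite subr_le0 orlicz_nonincreasing// ?ltW//; lra.
  rewrite gtr0_norm; last by lra.
  rewrite /k mulrAC ler_pdivlMr//.
  have := orlicz_convex h0 (ltW xy) (ltW lt_yx); lra.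
apply/cvgrPdist_lt => e e0; near=> y.
apply: le_lt_trans (lip y _) _.
  near: y; apply: lt_nbhsr; lra.
rewrite mulrC -ltr_pdivlMr//; near: y.
by apply: (@cvgr_dist_lt _ _ _ _ _ id); [exact: cvg_id|rewrite divr_gt0].
Unshelve. all: by end_near. Qed.

(** Convexity makes the difference quotients nondecreasing in the increment and bounds them below by
    the slope over [[1/2, 1]], so they converge. The limit is at most the quotient at increment 1,
    namely [phi 2 - phi 1 < 0]. *)
Lemma orlicz_right_derivative :
  is_right_derivative phi 1 (right_derivative phi 1) /\ right_derivative phi 1 < 0.
Proof.
pose s h := h^-1 * (phi (1 + h) - phi 1).
have s_nd h k : 0 < h -> h <= k -> s h <= s k.
  move=> h0 hk; have k0 := lt_le_trans h0 hk.
  rewrite /s ![_^-1 * _]mulrC ler_pdivrMr// mulrAC ler_pdivlMr//.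
  have := @orlicz_convex 1 (1 + h) (1 + k) ltr01.
  by move=> /(_ ltac:(lra) ltac:(lra)); lra.
have cs : cvg (s h @[h --> 0^'+]).
  apply: nondecreasing_at_right_is_cvgr.
    by apply: nearW => x h k; rewrite !in_itv/= => /andP[h0 hx] kx; exact: s_nd.
  apply: nearW => x; exists ((phi 1 - phi (1/2)) / (1/2)) => y [h /= + <-].
  rewrite in_itv/= => /andP[h0 _]; rewrite /s ler_pdivlMl//.
  have := @orlicz_convex (1/2) 1 (1 + h).
  by move=> /(_ ltac:(lra) ltac:(lra) ltac:(lra)); lra.
split; first exact: cs.
apply: (@le_lt_trans _ _ (phi 2 - phi 1)); last first.
  by rewrite subr_lt0 orlicz_decreasing//; lra.
apply: limr_le; first exact: cs.
near=> h; have -> : phi 2 - phi 1 = s 1 by rewrite /s invr1 mul1r.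
by apply: s_nd; near: h; [exact: nbhs_right_gt|exact: nbhs_right_le].
Unshelve. all: by end_near. Qed.

End orlicz_functions.

(** * The scalar equation on one ray: solvability, continuous dependence, bound and derivative *)

Section orlicz_combination.
Context {R : realType}.
Variable phi : R -> R.
Hypothesis hphi : orlicz_class phi.
Implicit Types (a b r e : R).

Let comb e a b r := phi (a / r) + e * phi (b / r).

(** Strictness comes from the first term, since [e] may vanish. *)
Lemma orlicz_comb_lt e a b r s : 0 <= e -> 0 < a -> 0 < b -> 0 < r -> r < s ->
  comb e a b r < comb e a b s.
Proof.
move=> e0 a0 b0 r0 rs; have s0 := lt_trans r0 rs.
apply: ltr_leD.
  by apply: orlicz_decreasing; rewrite ?divr_gt0// ltr_pM2l// ltf_pV2.
apply: ler_wpM2l => //; apply: orlicz_nonincreasing; rewrite ?divr_gt0//.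
by rewrite ler_pM2l// lef_pV2// ltW.
Qed.

(** Stated for an arbitrary filter, to be used with neighbourhoods restricted to the sphere. *)
Lemma orlicz_comb_cvg (T : Type) (F : set_system T) {FF : Filter F}
    (A B : T -> R) e a b r : 0 < a -> 0 < b -> 0 < r ->
  A @ F --> a -> B @ F --> b -> comb e (A t) (B t) r @[t --> F] --> comb e a b r.
Proof.
move=> a0 b0 r0 cA cB; apply: cvgD; last apply: cvgMr.
- apply: (@cvg_comp _ _ _ (fun t => A t / r) phi _ (nbhs (a / r))).
    exact: cvgMl.
  by apply: orlicz_continuous => //; rewrite divr_gt0.
- apply: (@cvg_comp _ _ _ (fun t => B t / r) phi _ (nbhs (b / r))).
    exact: cvgMl.
  by apply: orlicz_continuous => //; rewrite divr_gt0.
Qed.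

(** Intermediate value theorem on [[r0, a]]: at [a] the first term alone equals [phi 1], and for
    small radii both ratios are large, so both values of [phi] are small. *)
Lemma orlicz_comb_solution e a b : 0 <= e -> 0 < a -> 0 < b ->
  exists2 r, 0 < r & comb e a b r = phi 1.
Proof.
move=> e0 a0 b0; have p1 := orlicz_gt0 hphi (ltr01 : 0 < 1 :> R).
(* With both values of [phi] below this threshold, the weighted sum stays below [phi 1 / 2]. The
   factor 2 in [r0] makes both ratios strictly larger than [M]. *)
have [|M M0 HM] := @orlicz_small _ _ hphi (phi 1 / 2 / (1 + e)).
  by rewrite !divr_gt0//; lra.
pose r0 := Num.min a (Num.min (a / (2 * M)) (b / (2 * M))).
have r00 : 0 < r0 by rewrite !lt_min a0 !divr_gt0//; lra.
have small c : 0 < c -> r0 <= c / (2 * M) -> phi (c / r0) < phi 1 / 2 / (1 + e).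
  move=> c0 cM; apply: HM; rewrite ltr_pdivlMr//.
  move: cM; rewrite ler_pdivlMr; last lra.
  have : 0 < M * r0 by rewrite mulr_gt0.
  lra.
have lo : comb e a b r0 <= phi 1.
  have /small := a0; rewrite /r0 !ge_min lexx !orbT => /(_ isT); rewrite -/r0 => pa.
  have /small := b0; rewrite /r0 !ge_min lexx !orbT => /(_ isT); rewrite -/r0 => pb.
  have e1 : 0 < 1 + e by lra.
  move: pa pb; rewrite !ltr_pdivlMr// /comb => pa pb.
  rewrite -(ler_pM2r e1).
  have := ler_wpM2l e0 (ltW pb).
  have : 0 <= e * phi 1 by rewrite mulr_ge0// ltW.
  lra.
have hi : phi 1 <= comb e a b a.
  rewrite /comb divff ?gt_eqF// lerDl mulr_ge0// ltW// orlicz_gt0//.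
  by rewrite divr_gt0.
have r0a : r0 <= a by rewrite ge_min lexx.
have [| |r] := @IVT R (comb e a b) r0 a (phi 1) r0a.
- apply: continuous_in_subspaceT => r; rewrite inE/= in_itv/= => /andP[rr0 _].
  have rp : 0 < r by apply: lt_le_trans rr0.
  have cV : (fun t => t^-1) @ r --> r^-1.
    by apply: cvgV; [rewrite gt_eqF|exact: cvg_id].
  apply: cvgD; last apply: cvgMr.
  + apply: (@cvg_comp _ _ _ (fun t => a / t) phi _ (nbhs (a / r))).
      exact: cvgMr.
    by apply: orlicz_continuous => //; rewrite divr_gt0.
  + apply: (@cvg_comp _ _ _ (fun t => b / t) phi _ (nbhs (b / r))).
      exact: cvgMr.
    by apply: orlicz_continuous => //; rewrite divr_gt0.
- by rewrite ge_min lo le_max hi orbT.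
- rewrite in_itv/= => /andP[rr0 _] <-; exists r => //.
  exact: lt_le_trans rr0.
Qed.

(** At [r0 - d'] and [r0 + d'] the limiting expression lies strictly below and above [phi 1]. This
    persists for nearby parameters, and strict monotonicity in the radius traps [r t] between the
    two. *)
Lemma orlicz_comb_solution_cvg (T : Type) (F : set_system T) {FF : Filter F}
    (A B r : T -> R) e a b r0 : 0 <= e -> 0 < a -> 0 < b -> 0 < r0 ->
  A @ F --> a -> B @ F --> b ->
  (\forall t \near F, [/\ 0 < A t, 0 < B t, 0 < r t & comb e (A t) (B t) (r t) = phi 1]) ->
  comb e a b r0 = phi 1 -> r @ F --> r0.
Proof.
move=> e0 a0 b0 r00 cA cB hr hr0; apply/cvgrPdist_lt => d d0.
(* The cap [r0 / 2] keeps [r0 - d'] positive. *)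
pose d' := Num.min d (r0 / 2).
have d'0 : 0 < d' by rewrite lt_min d0; lra.
have d'd : d' <= d by rewrite ge_min lexx.
have d'r : d' <= r0 / 2 by rewrite ge_min lexx orbT.
have lo : comb e a b (r0 - d') < phi 1.
  by rewrite -hr0; apply: orlicz_comb_lt => //; lra.
have hi : phi 1 < comb e a b (r0 + d').
  by rewrite -hr0; apply: orlicz_comb_lt => //; lra.
have m0 : 0 < r0 - d' by lra.
have p0 : 0 < r0 + d' by lra.
have cl := orlicz_comb_cvg (FF := FF) (e := e) a0 b0 m0 cA cB.
have ch := orlicz_comb_cvg (FF := FF) (e := e) a0 b0 p0 cA cB.
have nl := cvgr_lt _ cl _ lo; have nh := cvgr_gt _ ch _ hi.
near=> t.
have [At Bt rt ht] : [/\ 0 < A t, 0 < B t, 0 < r t & comb e (A t) (B t) (r t) = phi 1].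
  by near: t.
have lt : comb e (A t) (B t) (r0 - d') < phi 1 by near: t; exact: nl.
have gt : phi 1 < comb e (A t) (B t) (r0 + d') by near: t; exact: nh.
have mono x y : 0 < x -> 0 < y -> comb e (A t) (B t) x < comb e (A t) (B t) y -> x < y.
  move=> x0 y0; rewrite !ltNge; apply: contra; rewrite le_eqVlt => /predU1P[->//|yx].
  by rewrite ltW// orlicz_comb_lt.
rewrite -ht in lt gt.
have {}lt := mono _ _ m0 rt lt; have {}gt := mono _ _ rt p0 gt.
by rewrite ltr_norml; lra.
Unshelve. all: by end_near. Qed.

(** Source of the dominating function: [phi 1 - phi (a / r) = e * phi (b / r)] is at most
    [e * phi (b / a)] because [r <= a], and [key] bounds the left side below by a multiple of
    [1 - r / a]. *)
Lemma orlicz_comb_solution_le e a b r : 0 <= e -> 0 < a -> 0 < b -> 0 < r ->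
  comb e a b r = phi 1 ->
  r <= a /\ a - r <= e * (a * phi (b / a) / (phi 1 - phi 2)).
Proof.
move=> e0 a0 b0 r0 hr.
have c0 : 0 < phi 1 - phi 2 by rewrite subr_gt0 orlicz_decreasing//; lra.
have pbr : 0 < phi (b / r) by rewrite orlicz_gt0// divr_gt0.
have ar0 : 0 < a / r by rewrite divr_gt0.
have ra : r <= a.
  rewrite leNgt; apply/negP => ar.
  have := @orlicz_decreasing _ _ hphi (a / r) 1 ar0.
  rewrite ltr_pdivrMr// mul1r => /(_ ar).
  by move: hr; rewrite /comb; have : 0 <= e * phi (b / r); [rewrite mulr_ge0// ltW|lra].
split=> //.
have pba : phi (b / r) <= phi (b / a).
  apply: orlicz_nonincreasing; rewrite ?divr_gt0//.
  by rewrite ler_pM2l// lef_pV2.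
(* If [a / r <= 2], the chord of [phi] over [[1, 2]] lies above the graph and
   [1 - r / a <= a / r - 1]; if [a / r > 2], [phi (a / r) <= phi 2] suffices. *)
have key : (1 - r / a) * (phi 1 - phi 2) <= phi 1 - phi (a / r).
  have ra1 : r / a <= 1 by rewrite ler_pdivrMr// mul1r.
  have ra0 : 0 < r / a by rewrite divr_gt0.
  have [t2|t2] := leP (a / r) 2.
    have t1 : 1 <= a / r by rewrite ler_pdivlMr// mul1r.
    have := orlicz_convex hphi ltr01 t1 t2.
    have : (1 - r / a) * (phi 1 - phi 2) <= (a / r - 1) * (phi 1 - phi 2).
      apply: ler_wpM2r; first exact: ltW.
      have : 0 <= (1 - r / a) * (a / r - 1) by rewrite mulr_ge0; lra.
      have : r / a * (a / r) = 1 by field; rewrite !gt_eqF.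
      lra.
    lra.
  have : phi (a / r) <= phi 2 by apply: orlicz_nonincreasing => //; exact: ltW.
  have : 0 <= r / a * (phi 1 - phi 2) by rewrite mulr_ge0// ltW.
  lra.
rewrite mulrA ler_pdivlMr//.
have -> : a - r = a * (1 - r / a) by field; rewrite gt_eqF.
rewrite -mulrA [leRHS]mulrCA ler_pM2l//; apply: le_trans key _.
apply: le_trans (ler_wpM2l e0 pba).
by move: hr; rewrite /comb; lra.
Qed.

(** Sequential form, as dominated convergence requires. *)
Lemma orlicz_comb_solution_derive (e r : R^nat) a b : 0 < a -> 0 < b ->
  (forall n, 0 < e n) -> e @ \oo --> 0 ->
  (forall n, 0 < r n /\ comb (e n) a b (r n) = phi 1) ->
  (e n)^-1 * (r n - a) @[n --> \oo] --> phi (b / a) * a / right_derivative phi 1.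
Proof.
move=> a0 b0 e0 ce hr.
have [dphi l0] := orlicz_right_derivative hphi.
set l := right_derivative phi 1 in dphi l0 *.
have r0 n : 0 < r n by case: (hr n).
have hrn n : comb (e n) a b (r n) = phi 1 by case: (hr n).
have cr : r @ \oo --> a.
  have le n := orlicz_comb_solution_le (ltW (e0 n)) a0 b0 (r0 n) (hrn n).
  apply: (squeeze_cvgr (f := fun n => a - e n * (a * phi (b / a) / (phi 1 - phi 2))) (h := cst a)).
  - by apply: nearW => n /=; have [-> le2] := le n; rewrite andbT; lra.
  - rewrite -[X in _ --> X]subr0 -[X in _ --> _ - X](mul0r (a * phi (b / a) / (phi 1 - phi 2))).
    by apply: cvgB; [exact: cvg_cst|exact: cvgMl].
  - exact: cvg_cst.
have crV : (r n)^-1 @[n --> \oo] --> a^-1 by apply: cvgV => //; rewrite gt_eqF.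
(* A positive increment at 1 tending to 0, along which the slopes of [phi] tend to [l]. *)
pose h n := a / r n - 1.
have pb n : 0 < phi (b / r n) by rewrite orlicz_gt0// divr_gt0.
have h0 n : 0 < h n.
  rewrite /h subr_gt0 ltr_pdivlMr// mul1r ltNge; apply/negP => ar.
  have := hrn n; rewrite /comb.
  have : 0 < e n * phi (b / r n) by rewrite mulr_gt0.
  have := @orlicz_nonincreasing _ _ hphi (a / r n) 1 (divr_gt0 a0 (r0 n)).
  rewrite ler_pdivrMr// mul1r => /(_ ar); lra.
have ch : h @ \oo --> 0.
  rewrite -(subrr 1) -[X in X - _](divff (lt0r_neq0 a0)).
  by apply: cvgB; [exact: cvgMr|exact: cvg_cst].
have cslope : (h n)^-1 * (phi (1 + h n) - phi 1) @[n --> \oo] --> l.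
  by move/cvg_at_rightP : dphi; apply.
have cphi : phi (b / r n) @[n --> \oo] --> phi (b / a).
  apply: (@cvg_comp _ _ _ (fun n => b / r n) phi _ (nbhs (b / a))); first exact: cvgMr.
  by apply: orlicz_continuous => //; rewrite divr_gt0.
(* The equation gives [phi (1 + h n) - phi 1 = - (e n * phi (b / r n))], while
   [r n - a = - (h n * r n)]; eliminating [e n] leaves the inverse slope. *)
have -> : (fun n => (e n)^-1 * (r n - a)) =
    (fun n => phi (b / r n) * r n * ((h n)^-1 * (phi (1 + h n) - phi 1))^-1).
  apply/funext => n; have := hrn n; rewrite /comb.
  have -> : 1 + h n = a / r n by rewrite /h; lra.
  move=> E; have -> : phi (a / r n) - phi 1 = - (e n * phi (b / r n)) by lra.
  have ra : r n < a by move: (h0 n); rewrite /h subr_gt0 ltr_pdivlMr// mul1r.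
  by rewrite /h; field; rewrite mulN1r subr_eq0 !gt_eqF.
by apply: cvgM; [exact: cvgM|apply: cvgV => //; rewrite lt_eqF].
Qed.

End orlicz_combination.

(** * Star bodies with a prescribed radial function *)

Section star_body_of_radial.
Context {R : realType}.
Variable n : nat.

(** The body is the image of the compact set [[0, 1]] times the sphere under the continuous map
    sending [(t, u)] to [t r(u) u]. *)
Lemma star_body_of_radial (r : 'rV[R]_n -> R) :
  (forall u, sphere n u -> 0 < r u) -> {within @sphere R n, continuous r} ->
  exists M, star_body M /\ forall u, sphere n u -> radial M u = r u.
Proof.
move=> r0 cr.
pose g (p : R * 'rV[R]_n) := (p.1 * r p.2) *: p.2.
pose M := g @` (`[0, 1]%classic `*` @sphere R n).
have rM u : sphere n u -> radial M u = r u.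
  move=> Su; rewrite /radial (_ : [set c | _] = `[0, r u]%classic).
    by rewrite sup_itv// bnd_simp ltW// r0.
  apply/seteqP; split => c /=; rewrite in_itv/=.
    move=> [c0 [[t v] /= []]]; rewrite in_itv/= => /andP[t0 t1] Sv E.
    have tr0 : 0 <= t * r v by rewrite mulr_ge0// ltW// r0.
    have ctr : t * r v = c.
      have := congr1 (@enorm R n) E.
      by rewrite /g/= !enormZ// Su Sv !mulr1.
    (* The origin does not determine the direction [v], so it is treated apart. *)
    have [->|cN0] := eqVneq c 0; first by rewrite lexx ltW// r0.
    have uv : v = u.
      by move: E; rewrite /g/= ctr => /(scalerI cN0).
    by rewrite c0 -ctr uv ler_piMl// ltW// r0.
  move=> /andP[c0 cr0]; split => //; exists (c / r u, u) => /=.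
    split => //=; rewrite in_itv/= ler_pdivrMr ?mul1r ?r0// cr0 andbT.
    by rewrite divr_ge0// ltW// r0.
  by rewrite /g/= divfK// gt_eqF// r0.
exists M; split => //; split.
- apply: continuous_compact; last first.
    by apply: compact_setX; [exact: segment_compact|exact: sphere_compact].
  apply/subspace_continuousP => -[t u] [/= _ Su].
  have cr' := (subspace_continuousP _ _).1 cr u Su.
  have csnd : snd @ within (`[0, 1]%classic `*` @sphere R n) (nbhs (t, u)) --> u.
    by apply: cvg_within_filter; exact: cvg_snd.
  apply: (@cvgZ _ _ _ _ _ (fun p : R * 'rV[R]_n => p.1 * r p.2) snd) => //.
  apply: cvgM.
    by apply: cvg_within_filter; exact: cvg_fst.
  apply: (@cvg_comp _ _ _ snd r _ (within (@sphere R n) (nbhs u))) => //.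
  move=> A /= HA; rewrite /within/=.
  have := csnd _ HA; rewrite !nbhs_simpl /within/=.
  by apply: filterS => -[s v] /= H [s01 Sv]; exact: H.
- move=> x t [[s u] /= [+ Su] <-]; rewrite in_itv/= => /andP[s0 s1] /andP[t0 t1].
  exists (t * s, u) => /=; last by rewrite /g/= scalerA mulrA.
  by split => //=; rewrite in_itv/= mulr_ge0//= mulr_ile1.
- by move=> u Su; rewrite rM// r0.
- apply/subspace_continuousP => u Su; rewrite /from_subspace rM//.
  have /subspace_continuousP/(_ u Su) := cr; apply: cvg_trans.
  apply: fmap_within_eq => v; rewrite inE => Sv; exact: rM.
Qed.

Lemma within_continuous_prod (I : Type) (s : seq I) (P : pred I) (A : set 'rV[R]_n)
    (f : I -> 'rV[R]_n -> R) : (forall i, {within A, continuous (f i)}) ->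
  {within A, continuous (fun u => \prod_(i <- s | P i) f i u)}.
Proof.
move=> cf; apply/subspace_continuousP => x Ax; rewrite /from_subspace.
elim: s => [|i s IH].
  by under eq_fun do rewrite big_nil; rewrite big_nil; exact: cvg_cst.
under eq_fun do rewrite big_cons; rewrite big_cons.
case: (P i) => //; apply: cvgM => //.
exact: (subspace_continuousP _ _).1 (cf i) x Ax.
Qed.

End star_body_of_radial.

(** * Existence of the Orlicz harmonic combination *)

Section orlicz_harmonic_combination.
Context {R : realType}.
Variables (n : nat) (phi : R -> R).
Hypothesis hphi : orlicz_class phi.
Variables K L : set 'rV[R]_n.
Hypotheses (hK : star_body K) (hL : star_body L).

(** The equation is solved ray by ray; the solutions depend continuously on the direction, hence
    form the radial function of a star body. *)
Lemma orlicz_harmonic_combP e : 0 <= e ->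
  star_body (orlicz_harmonic_comb phi K e L) /\
  forall u, sphere n u ->
    phi (radial K u / radial (orlicz_harmonic_comb phi K e L) u) +
    e * phi (radial L u / radial (orlicz_harmonic_comb phi K e L) u) = phi 1.
Proof.
move=> e0; rewrite /orlicz_harmonic_comb; set P := [set M | _].
(* One witness suffices: [xget] returns the default [set0] only if no set satisfies [P]. *)
suff : exists M, P M by move/(xgetPex set0).
have [_ _ K0 cK] := hK; have [_ _ L0 cL] := hL.
have /choice[r hr] (u : 'rV[R]_n) : exists r, sphere n u ->
    0 < r /\ phi (radial K u / r) + e * phi (radial L u / r) = phi 1.
  have [Su|Su] := pselect (sphere n u); last by exists 0.
  by have [r r0 hr] := orlicz_comb_solution hphi e0 (K0 u Su) (L0 u Su); exists r.
have [M [sM rM]] : exists M, star_body M /\ forall u, sphere n u -> radial M u = r u.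
  apply: star_body_of_radial => [u /hr[]//|].
  apply/subspace_continuousP => u Su; have [ru0 hu] := hr _ Su.
  apply: (@orlicz_comb_solution_cvg _ _ hphi _ (within (@sphere R n) (nbhs u)) _
    (radial K) (radial L) r e (radial K u) (radial L u) (r u)) => //.
  - exact: K0.
  - exact: L0.
  - exact: (subspace_continuousP _ _).1 cK u Su.
  - exact: (subspace_continuousP _ _).1 cL u Su.
  - rewrite near_withinE; apply: nearW => v Sv; have [rv hv] := hr v Sv.
    by split => //; [exact: K0|exact: L0].
by exists M; split => // u Su; rewrite rM//; case: (hr u Su).
Qed.

(** At [e = 0] the equation says that [phi] takes the value [phi 1] at the ratio of the radii, and
    [phi] is injective. *)
Lemma radial_orlicz_harmonic_comb0 u : sphere n u ->
  radial (orlicz_harmonic_comb phi K 0 L) u = radial K u.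
Proof.
move=> Su; have [[_ _ M0 _] /(_ u Su)] := orlicz_harmonic_combP (lexx 0).
have [_ _ K0 _] := hK.
rewrite mul0r addr0 => /(orlicz_inj hphi) -/(_ _ ltr01) E.
have /divr1_eq := E (divr_gt0 (K0 u Su) (M0 u Su)).
by move=> ->.
Qed.

End orlicz_harmonic_combination.

(** * Differentiation of the dual mixed volume under the integral sign *)

Lemma dual_mixed_volume_with (R : realType) n (K : 'I_n.+1 -> set 'rV[R]_n.+1) M :
  dual_mixed_volume [eta K with ord0 |-> M] =
  n.+1%:R^-1 * \int[sphere_measure n.+1]_(u in sphere n.+1)
    (radial M u * \prod_(i < n.+1 | i != ord0) radial (K i) u).
Proof.
rewrite /dual_mixed_volume; congr (_ * _); apply: eq_Rintegral => u _.
rewrite (bigD1 ord0)//= ; congr (_ * _).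
by apply: eq_bigr => i /negbTE ->.
Qed.

Lemma Rintegral_dominated_convergence d (T : measurableType d) (R : realType)
    (mu : {measure set T -> \bar R}) (D : set T) (f_ : nat -> T -> R) (f g : T -> R) :
  measurable D -> (forall k, measurable_fun D (f_ k)) -> measurable_fun D f ->
  (forall x, D x -> f_ k x @[k --> \oo] --> f x) ->
  mu.-integrable D (EFin \o g) -> (forall k x, D x -> `|f_ k x| <= g x) ->
  \int[mu]_(x in D) f_ k x @[k --> \oo] --> \int[mu]_(x in D) f x.
Proof.
move=> mD mf_ mf cf ig fg.
have [||||if_ _ cvf] := @dominated_convergence _ _ _ mu D mD
    (fun k x => (f_ k x)%:E) (EFin \o f) (EFin \o g) _ _ _ ig.
- by move=> k; exact/measurable_EFinP.
- exact/measurable_EFinP.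
- by apply: aeW => x Dx; apply/cvg_EFin; [exact: nearW|exact: cf].
- by apply: aeW => x k Dx; rewrite lee_fin fg.
apply: fine_cvg; rewrite fineK; first exact: cvf.
exact: integrable_fin_num.
Qed.

(** Indices start at [ord0], which stands for index 1; the dimension [n.+1] ensures that it
    exists. *)
Theorem lemma4p3 (R : realType) (n : nat)
    (L1 : set 'rV[R]_n.+1) (K : 'I_n.+1 -> set 'rV[R]_n.+1) (phi : R -> R)
    (hL1 : star_body L1) (hK : forall i, star_body (K i))
    (hphi : orlicz_class phi) :
  is_right_derivative
    (fun eps : R => dual_mixed_volume
       [eta K with ord0 |-> orlicz_harmonic_comb phi L1 eps (K ord0)])
    0
    ((n.+1%:R * right_derivative phi 1)^-1 *
     \int[sphere_measure n.+1]_(u in sphere n.+1)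
       (phi (radial (K ord0) u / radial L1 u) * radial L1 u *
        \prod_(i < n.+1 | i != ord0) radial (K i) u)).
Proof.
have [_ l0] := orlicz_right_derivative hphi.
have [_ _ rL0 cL] := hL1.
have rK0 i u : sphere n.+1 u -> 0 < radial (K i) u.
  by have [_ _ + _] := hK i; exact.
have cK i : {within sphere n.+1, continuous (radial (K i))} by have [] := hK i.
set l := right_derivative phi 1 in l0 *.
pose P (u : 'rV[R]_n.+1) := \prod_(i < n.+1 | i != ord0) radial (K i) u.
have P0 u : sphere n.+1 u -> 0 <= P u.
  by move=> Su; apply: prodr_ge0 => i _; rewrite ltW// rK0.
have cP : {within sphere n.+1, continuous P} by exact: within_continuous_prod.
pose G (u : 'rV[R]_n.+1) := phi (radial (K ord0) u / radial L1 u) * radial L1 u * P u.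
have cG : {within sphere n.+1, continuous G}.
  apply/subspace_continuousP => u Su.
  have cKu := (subspace_continuousP _ _).1 (cK ord0) u Su.
  have cLu := (subspace_continuousP _ _).1 cL u Su.
  have cPu := (subspace_continuousP _ _).1 cP u Su.
  apply: cvgM => //; apply: cvgM => //.
  apply: (@cvg_comp _ _ _ (fun v => radial (K ord0) v / radial L1 v) phi _
    (nbhs (radial (K ord0) u / radial L1 u))).
    by apply: cvgM => //; apply: cvgV => //; rewrite gt_eqF// rL0.
  by apply: orlicz_continuous => //; rewrite divr_gt0// ?rK0// rL0.
have cZ (c : R) (f : 'rV[R]_n.+1 -> R) : {within sphere n.+1, continuous f} ->
    {within sphere n.+1, continuous (fun u => c * f u)}.
  move=> cf; apply/subspace_continuousP => u Su; apply: cvgMr.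
  exact: (subspace_continuousP _ _).1 cf u Su.
have cMP (f : 'rV[R]_n.+1 -> R) : {within sphere n.+1, continuous f} ->
    {within sphere n.+1, continuous (fun u => f u * P u)}.
  move=> cf; apply/subspace_continuousP => u Su; apply: cvgM.
    exact: (subspace_continuousP _ _).1 cf u Su.
  exact: (subspace_continuousP _ _).1 cP u Su.
have mS := @measurable_sphere R n.+1.
(* The right limit is tested on sequences of positive [e k] tending to 0. *)
rewrite /is_right_derivative; apply/cvg_at_rightP => e [e0 ce].
pose M k := orlicz_harmonic_comb phi L1 (e k) (K ord0).
have hM k := orlicz_harmonic_combP hphi hL1 (hK ord0) (ltW (e0 k)).
have rM0 k u : sphere n.+1 u -> 0 < radial (M k) u by have [[_ _ + _] _] := hM k; exact.
have cM k : {within sphere n.+1, continuous (radial (M k))} by have [[]] := hM k.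
pose f_ k u := (e k)^-1 * (radial (M k) u * P u - radial L1 u * P u).
have cf_ k : {within sphere n.+1, continuous (f_ k)}.
  apply: (cZ _ (fun u => radial (M k) u * P u - radial L1 u * P u)).
  apply/subspace_continuousP => u Su; apply: cvgB.
    exact: (subspace_continuousP _ _).1 (cMP _ (cM k)) u Su.
  exact: (subspace_continuousP _ _).1 (cMP _ cL) u Su.
have quotE k : (e k)^-1 *
    (dual_mixed_volume [eta K with ord0 |-> orlicz_harmonic_comb phi L1 (0 + e k) (K ord0)] -
     dual_mixed_volume [eta K with ord0 |-> orlicz_harmonic_comb phi L1 0 (K ord0)]) =
    n.+1%:R^-1 * \int[sphere_measure n.+1]_(u in sphere n.+1) f_ k u.
  rewrite add0r !dual_mixed_volume_with -mulrBr mulrCA; congr (_ * _).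
  (* The combination at 0 has the radial function of [L1] on the sphere, which is all that the
     integral sees. *)
  rewrite [X in _ - X](_ : _ = \int[sphere_measure n.+1]_(u in sphere n.+1) (radial L1 u * P u)).
    rewrite -RintegralB//; last 2 first.
    - exact: sphere_continuous_integrable (cMP _ (cM k)).
    - exact: sphere_continuous_integrable (cMP _ cL).
    rewrite -RintegralZl//; apply: sphere_continuous_integrable.
    apply/subspace_continuousP => u Su; apply: cvgB.
      exact: (subspace_continuousP _ _).1 (cMP _ (cM k)) u Su.
    exact: (subspace_continuousP _ _).1 (cMP _ cL) u Su.
  by apply: eq_Rintegral => u; rewrite inE => Su; rewrite radial_orlicz_harmonic_comb0.
rewrite [X in X @ _ --> _](_ : _ = fun k =>
    n.+1%:R^-1 * \int[sphere_measure n.+1]_(u in sphere n.+1) f_ k u); last first.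
  by apply/funext => k; exact: quotE.
rewrite invfM -mulrA; apply: cvgMr.
rewrite -RintegralZl//; last exact: (sphere_continuous_integrable cG).
(* The scalar bound on each ray, multiplied by [P u], gives the dominating function [c^-1 * G u]. *)
pose c := phi 1 - phi 2.
have c0 : 0 < c by rewrite subr_gt0 orlicz_decreasing//; lra.
apply: (@Rintegral_dominated_convergence _ _ _ _ _ _ _ (fun u => c^-1 * G u)) => //.
- by move=> k; exact: sphere_continuous_measurable.
- by apply: sphere_continuous_measurable; exact: (cZ _ G).
- move=> u Su.
  have h := @orlicz_comb_solution_derive _ _ hphi e (fun k => radial (M k) u)
    _ _ (rL0 u Su) (rK0 ord0 u Su) e0 ce.
  have -> : f_^~ u = fun k => (e k)^-1 * (radial (M k) u - radial L1 u) * P u.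
    by apply/funext => k; rewrite /f_ -mulrBl mulrA.
  rewrite [X in _ --> X](_ : _ = phi (radial (K ord0) u / radial L1 u) * radial L1 u / l * P u).
    by apply: cvgMl; apply: h => k; split; [exact: rM0|have [_] := hM k; exact].
  by rewrite mulrA; congr (_ * _); rewrite mulrC.
- exact: sphere_continuous_integrable (cZ _ _ cG).
- move=> k u Su.
  have [_ /(_ u Su) eM] := hM k.
  have [le1 le2] := orlicz_comb_solution_le hphi (ltW (e0 k)) (rL0 u Su)
    (rK0 ord0 u Su) (rM0 k u Su) eM.
  rewrite /f_ -mulrBl !normrM normfV (gtr0_norm (e0 k)) (ger0_norm (P0 u Su)).
  rewrite distrC ger0_norm ?subr_ge0//.
  rewrite mulrA [G u]/G !mulrA; apply: ler_wpM2r; first exact: P0.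
  rewrite mulrC ler_pdivrMr//; apply: le_trans le2 _.
  by rewrite le_eqVlt; apply/orP; left; apply/eqP; rewrite -/c; field; rewrite gt_eqF.
Qed.
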